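(* Let $n\ge 1$ be an integer, let $\alpha, c$ be real numbers, and let $SL_n$ be the silicate network of dimension $n$. Then $$\Pi_{1,c}(SL_n)=2^{9n^2c-3nc}\,3^{15n^2c+3nc},$$ $$\Pi_2(SL_n)=2^{54n^2-18n}\,3^{72n^2},$$ $$\chi_\alpha(SL_n)=n\,6^{\alpha+1}+3^{2\alpha+1}(6n^2+2n)+2^{2\alpha+1}3^{\alpha+1}(3n^2-2n),$$ $$\Pi_1^*(SL_n)=2^{36n^2-18n}\,3^{54n^2+6n}.$$
   Context: All graphs are finite, simple and connected; $d(v)$ is the degree of the vertex $v$ in $G=(V(G),E(G))$. For real $c,\alpha$ define $$\Pi_{1,c}(G)=\prod_{v\in V(G)}d(v)^c,\quad \Pi_2(G)=\prod_{uv\in E(G)}d(u)d(v)=\prod_{u\in V(G)}d(u)^{d(u)},$$ $$\Pi_1^*(G)=\prod_{uv\in E(G)}(d(u)+d(v)),\quad \chi_\alpha(G)=\sum_{uv\in E(G)}(d(u)+d(v))^\alpha.$$ Honeycomb network $HC_n$: $HC_1$ is a hexagon (6-cycle), and $HC_n$ is obtained from $HC_{n-1}$ by adding a layer of hexagons of the regular hexagonal tiling of the plane around the boundary of $HC_{n-1}$. Equivalently, $HC_n$ consists of the vertices and edges of all hexagons of the tiling at distance at most $n-1$ from a fixed central hexagon, where distance is the graph distance in which two hexagons are adjacent when they share an edge. Silicate network $SL_n$: start from $HC_n$ and call its vertices silicon vertices. Put one oxygen vertex on each edge of $HC_n$ (it is associated with the two silicon vertices that are endpoints of that edge), and for each of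 the $6n$ vertices of degree 2 of $HC_n$ add one further oxygen vertex associated only with that silicon vertex. Each silicon vertex then has exactly three associated oxygen vertices. The vertices of $SL_n$ are all silicon and oxygen vertices, and the edges are those making each silicon vertex together with its three associated oxygen vertices a complete graph $K_4$ (an $SiO_4$ tetrahedron), with no other edges. Thus $|V(SL_n)|=15n^2+3n$ and $|E(SL_n)|=36n^2$. *)

(* Defs.v *)
From HB Require Import structures.
From mathcomp Require Import all_boot all_order all_algebra.
From mathcomp Require Import finmap.
From mathcomp Require Import reals exp.
Set Implicit Arguments.
Unset Strict Implicit.
Unset Printing Implicit Defensive.
Import Order.TTheory GRing.Theory Num.Theory.
Local Open Scope fset_scope.
Local Open Scope ring_scope.

Record sgraph := SGraph {
  vert :> finType;
  adj : rel vert;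
  adj_sym : symmetric adj;
  adj_irr : irreflexive adj
}.
Arguments adj {s}.

Definition deg (G : sgraph) (v : G) : nat := #|[set u : G | adj v u]|.

Definition edges (G : sgraph) : {set {set G}} :=
  [set [set u; v] | u in [set: G], v in [set: G] & adj u v].

Definition Pi1c (R : realType) (c : R) (G : sgraph) : R :=
  \prod_(v : G) (deg v)%:R `^ c.

(* An edge e is the two-element set of its ends u and v, so that
   d(u) + d(v) is \sum_(v in e) deg v, and likewise for d(u) * d(v). *)
Definition Pi2 (G : sgraph) : nat :=
  (\prod_(e in edges G) \prod_(v in e) deg v)%N.

Definition Pi1star (G : sgraph) : nat :=
  (\prod_(e in edges G) \sum_(v in e) deg v)%N.

Definition chi (R : realType) (alpha : R) (G : sgraph) : R :=
  \sum_(e in edges G) (\sum_(v in e) deg v)%:R `^ alpha.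

(* The hexagonal tiling of the plane with unit edges.  The pair (x, y) stands
   for the point x + y * w of the triangular lattice Z[w], w = exp(i pi / 3).
   The points with x = y mod 3 are the centres of the hexagons, and the other
   lattice points are the vertices of the tiling: the hexagon of centre h has
   the vertices h + u and its edges join those at unit distance, where u runs
   over the six lattice vectors of length 1. *)
Definition point : Type := (int * int)%type.

Definition unit_vectors : seq point :=
  [:: (1, 0); (0, 1); (-1, 1); (-1, 0); (0, -1); (1, -1)].

Definition unit_dist (p q : point) : bool := q - p \in unit_vectors.

Definition is_centre (h : point) : bool := (h.1 == h.2 %[mod 3])%Z.

Definition hexagon (h : point) : {fset point} :=
  [fset h + u | u in unit_vectors].

Definition hex_edge (h p q : point) : bool :=
  [&& p \in hexagon h, q \in hexagon h & unit_dist p q].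

Definition hex_adj (h k : point) : bool :=
  (h != k) && [exists p : hexagon h, exists q : hexagon h,
                 hex_edge h (val p) (val q) && hex_edge k (val p) (val q)].

Definition hex_nbrs (h : point) : {fset point} :=
  [fset k in [fset h + u - v | u in unit_vectors, v in unit_vectors]
     | is_centre k && hex_adj h k].

Lemma in_hex_nbrs h k : (k \in hex_nbrs h) = is_centre k && hex_adj h k.
Proof.
rewrite !inE /=; case hk: (is_centre k && hex_adj h k); last by rewrite andbF.
case/andP: hk => _ /andP[_ /existsP[p /existsP[q /andP[_ /and3P[pk _ _]]]]].
rewrite andbT; case/imfsetP: pk => v /= hv pv.
case/imfsetP: (valP p) => u /= hu pu.
by apply/imfset2P; exists u => //; exists v; rewrite // -pu pv addrK.
Qed.

(* The centres of the hexagons at distance at most m from the hexagon of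
   centre 0, obtained by adding m layers around it. *)
Fixpoint hex_ball (m : nat) : {fset point} :=
  if m is m'.+1 then
    hex_ball m' `|` \bigcup_(h <- hex_ball m') hex_nbrs h
  else [fset 0].

Definition HC_vert (n : nat) : {fset point} :=
  \bigcup_(h <- hex_ball n.-1) hexagon h.

Definition HC_adj (n : nat) : rel (HC_vert n) :=
  fun p q => [exists h : hex_ball n.-1, hex_edge (val h) (val p) (val q)].

Lemma unit_dist_sym : symmetric unit_dist.
Proof.
have H p q : unit_dist p q -> unit_dist q p.
  rewrite /unit_dist -(opprB q p); move: (q - p) => r.
  by rewrite !inE => /or4P[/eqP->|/eqP->|/eqP->|/or3P[]/eqP->].
by move=> p q; apply/idP/idP; apply: H.
Qed.

Lemma HC_adj_sym n : symmetric (@HC_adj n).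
Proof.
move=> p q; apply: eq_existsb => h.
by rewrite /hex_edge unit_dist_sym andbCA.
Qed.

Lemma HC_adj_irr n : irreflexive (@HC_adj n).
Proof.
by move=> p; apply/existsP => -[h]; rewrite /hex_edge /unit_dist subrr !andbF.
Qed.

(* The honeycomb network of dimension n >= 1 (HC 0 is the same as HC 1). *)
Definition HC (n : nat) : sgraph := SGraph (@HC_adj_sym n) (@HC_adj_irr n).

Definition oxygen (G : sgraph) : finType :=
  ({e : {set G} | e \in edges G} + {v : G | deg v == 2})%type.

Definition associated (G : sgraph) (s : G) (o : oxygen G) : bool :=
  match o with
  | inl e => s \in val e
  | inr v => s == val v
  end.

Definition sil_vert (G : sgraph) : finType := (G + oxygen G)%type.

Definition tetrahedron (G : sgraph) (s : G) : {set sil_vert G} :=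
  inl s |: [set inr o | o in [set o | associated s o]].

Definition sil_adj (G : sgraph) : rel (sil_vert G) := fun x y =>
  (x != y) && [exists s : G, (x \in tetrahedron s) && (y \in tetrahedron s)].

Lemma sil_adj_sym G : symmetric (@sil_adj G).
Proof.
by move=> x y; rewrite /sil_adj eq_sym; congr andb;
   apply: eq_existsb => s; rewrite andbC.
Qed.

Lemma sil_adj_irr G : irreflexive (@sil_adj G).
Proof. by move=> x; rewrite /sil_adj eqxx. Qed.

Definition silicate (G : sgraph) : sgraph :=
  SGraph (@sil_adj_sym G) (@sil_adj_irr G).

Definition SL (n : nat) : sgraph := silicate (HC n).

(* Main.v *)
Require Import Defs.
From HB Require Import structures.
From mathcomp Require Import all_boot all_order all_algebra.
From mathcomp Require Import finmap zify ring.
From mathcomp Require Import reals exp.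
Import Order.TTheory GRing.Theory Num.Theory.
Set Implicit Arguments.
Unset Strict Implicit.

(** Two independent facts give the four formulas.

    First, let G be any graph with all degrees 2 or 3, with V vertices, of
    which t have degree 2, and E edges.  In its silicate every silicon vertex
    has exactly three associated oxygens, so every tetrahedron has four
    vertices.  A vertex lying in one tetrahedron has degree 3; an oxygen placed
    on an edge of G lies in the two tetrahedra of the ends of that edge, which
    share nothing else, so it has degree 6.  Hence there are V + t vertices of
    degree 3 and E of degree 6 ([big_silicate_vertices]), with 2E + t = 3V by
    the handshake lemma.  The sum of the degrees of the ends of an edge is 6, 9
    or 12.  The value 6 occurs only on the edges joining a silicon vertex of
    degree 2 in G to its extra oxygen, hence t times; counting incidences of
    edges with the vertices of degree 6, and all incidences, then yields
    3V + t edges with the value 9 and 3V - 2t with the value 12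
    ([big_silicate_edges]).

    Second, the honeycomb network of dimension n has V = 6n^2 and t = 6n.
    The centres of its hexagons are those in a larger regular hexagon of the
    plane ([mem_hex_ball]).  The rotation by 60 degrees preserves the
    network, and the six turns of a single n by n rhombus of lattice points
    cover its vertices without repetition ([HC_index_bij]).  In one rhombus the
    degree can be read off directly: it is 2 on one of the outer sides, the row
    b = n - 1, and 3 elsewhere ([deg_HC_index]).

    Substituting V and t in the counts of the first part turns each index into
    an elementary product or sum of powers of 2 and 3. *)

(** * Edges and degrees *)

Lemma edgesP (G : sgraph) (e : {set G}) :
  reflect (exists u v, adj u v /\ e = [set u; v]) (e \in edges G).
Proof.
apply: (iffP imset2P) => [[u v _] | [u [v [uv ->]]]].
  by rewrite inE => /andP[_ uv] ->; exists u, v.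
by exists u v; rewrite ?inE.
Qed.

Lemma adj_neq (G : sgraph) (u v : G) : adj u v -> u != v.
Proof. by apply: contraTneq => ->; rewrite adj_irr. Qed.

Lemma card_edges_at (G : sgraph) (v : G) :
  #|[set e in edges G | v \in e]| = deg v.
Proof.
have -> : [set e in edges G | v \in e] = [set [set v; u] | u in [set u | adj v u]].
  apply/setP => e; rewrite inE; apply/andP/imsetP.
    case=> /edgesP[a [b [ab ->]]]; rewrite !inE => /orP[/eqP->|/eqP->].
      by exists b; rewrite ?inE.
    by exists a; rewrite 1?setUC ?inE // adj_sym.
  case=> u; rewrite inE => vu ->; split; last by rewrite !inE eqxx.
  by apply/edgesP; exists v, u.
rewrite card_in_imset // => a b; rewrite !inE => va _ /setP/(_ a).
rewrite !inE eqxx orbT => /esym/orP[/eqP eav|/eqP//].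
by have := adj_neq va; rewrite eav eqxx.
Qed.

(** Incidences of edges with vertices of D, counted in two ways.  The
    restriction to D lets the lemma count the ends of a given degree. *)
Lemma handshake (G : sgraph) (D : {set G}) :
  (\sum_(e in edges G) #|[set v in e | v \in D]| = \sum_(v in D) deg v)%N.
Proof.
under eq_bigr do rewrite -sum1_card.
rewrite (exchange_big_dep (mem D)) /=; last by move=> e v _; rewrite inE => /andP[].
apply: eq_bigr => v vD; rewrite -card_edges_at -sum1_card.
by apply: eq_bigl => e; rewrite !inE vD andbT.
Qed.

Lemma card_edge (G : sgraph) (e : {set G}) : e \in edges G -> #|e| = 2.
Proof. by case/edgesP => u [v [uv ->]]; rewrite cards2 (adj_neq uv). Qed.

Lemma card_edges (G : sgraph) : (2 * #|edges G| = \sum_(v : G) deg v)%N.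
Proof.
rewrite -(eq_bigl _ _ (fun v => in_setT v)) -handshake mulnC -sum_nat_const.
apply: eq_bigr => e he; rewrite -[LHS](card_edge he); apply: eq_card => v.
by rewrite !inE andbT.
Qed.

Lemma Pi2_vertices (G : sgraph) : (Pi2 G = \prod_(v : G) deg v ^ deg v)%N.
Proof.
rewrite /Pi2 (exchange_big_dep predT) //=; apply: eq_bigr => v _.
rewrite prod_nat_const -card_edges_at; congr (_ ^ _)%N.
by apply: eq_card => e; rewrite !inE.
Qed.

(** Written with an abstract operation so that one count of the fibres of k
    serves for sums of reals and for products of integers. *)
Lemma big_fibres (R : Type) (idx : R) (op : Monoid.com_law idx) (I : finType)
    (A : {set I}) (N : nat) (k : I -> nat) (g : nat -> R) :
  (forall i, i \in A -> k i < N) ->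
  \big[op/idx]_(i in A) g (k i) =
  \big[op/idx]_(j < N) iter #|[set i in A | k i == j]| (op (g j)) idx.
Proof.
case: N => [|N] kN.
  by rewrite big_ord0; apply: big_pred0 => i; apply/negP => /kN.
rewrite (partition_big (fun i => inord (k i) : 'I_N.+1) predT) //=.
apply: eq_bigr => j _; rewrite -big_const.
apply: eq_big => i; last first.
  by case/andP => /kN ki /eqP <-; rewrite inordK.
rewrite inE; apply: andb_id2l => /kN ki.
by rewrite -val_eqE /= inordK.
Qed.

(** * The silicate of a graph with all degrees 2 or 3 *)

Section Silicate.
Context (G : sgraph) (deg23 : forall v : G, deg v = 2 \/ deg v = 3).
Local Notation S := (silicate G).

Lemma in_tetra_sil (s t : G) : ((inl t : sil_vert G) \in tetrahedron s) = (t == s).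
Proof.
rewrite !inE; case: imsetP => [[] // | _]; rewrite orbF.
by apply/eqP/eqP => [[]|->].
Qed.

Lemma in_tetra_oxy (s : G) (o : oxygen G) :
  ((inr o : sil_vert G) \in tetrahedron s) = associated s o.
Proof.
rewrite !inE; case: eqP => //= _; rewrite mem_imset ?inE //.
by move=> a b [].
Qed.

(** The oxygens on the edges at s number d(s), and the extra oxygen makes up
    for the missing edge exactly when d(s) = 2. *)
Lemma card_associated (s : G) : #|[set o : oxygen G | associated s o]| = 3.
Proof.
rewrite -sum1_card big_sumType /=.
rewrite (eq_bigl (fun e : {e | e \in edges G} => s \in val e)); last by move=> e; rewrite inE.
rewrite (eq_bigl (fun v : {v : G | deg v == 2} => s == val v)); last by move=> e; rewrite inE.
rewrite !sum1_card.
have -> : #|[pred e : {e | e \in edges G} | s \in val e]| = deg s.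
  rewrite -card_edges_at -(card_imset _ val_inj); apply: eq_card => e; rewrite inE.
  apply/imsetP/andP => [[f fs ->]|[es se]]; first by rewrite (valP f).
  by exists (exist _ e es).
have -> : #|[pred v : {v : G | deg v == 2} | s == val v]| = (deg s == 2).
  case: (boolP (deg s == 2)) => ds.
    rewrite -[RHS](card1 (exist _ s ds : {v : G | deg v == 2})); apply: eq_card => v.
    by rewrite !inE -val_eqE eq_sym.
  apply: eq_card0 => v; rewrite !inE; apply/eqP => e.
  by move: ds; rewrite e (valP v).
by case: (deg23 s) => ->.
Qed.

Lemma card_tetra (s : G) : #|tetrahedron s| = 4.
Proof.
rewrite cardsU1 card_imset; last by move=> a b [].
by rewrite card_associated; case: imsetP => [[] |].
Qed.

Lemma tetra_nbrs (x : S) :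
  [set y | adj x y] = (\bigcup_(s | x \in tetrahedron s) tetrahedron s) :\ x.
Proof.
apply/setP => y; rewrite !inE /= /sil_adj eq_sym; congr andb.
apply/existsP/bigcupP => [[s /andP[]]|[s]]; first by exists s.
by exists s; apply/andP.
Qed.

Lemma deg_corner (x : S) (s : G) :
  (forall t, (x \in tetrahedron t) = (t == s)) -> deg x = 3.
Proof.
move=> xs; rewrite /deg tetra_nbrs (eq_bigl _ _ xs) big_pred1_eq.
by have := cardsD1 x (tetrahedron s); rewrite xs eqxx card_tetra => -[].
Qed.

Lemma deg_silicon (s : G) : deg (inl s : S) = 3.
Proof. by apply: (deg_corner (s := s)) => t; rewrite in_tetra_sil eq_sym. Qed.

Lemma deg_pendant (v : {v : G | deg v == 2}) : deg (inr (inr v) : S) = 3.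
Proof. by apply: (deg_corner (s := val v)) => t; rewrite in_tetra_oxy. Qed.

(** An oxygen on an edge is associated with both ends only when it sits on the
    edge joining them, because G is simple. *)
Lemma tetraI (u v : G) (e : {e : {set G} | e \in edges G}) :
  u != v -> val e = [set u; v] ->
  tetrahedron u :&: tetrahedron v = [set inr (inl e)].
Proof.
move=> uv ee; apply/setP => -[s|[f|w]]; rewrite inE ?in_tetra_sil ?in_tetra_oxy inE.
- by case: eqP => //= ->; exact/negbTE.
- apply/andP/eqP => /= [[uf vf]|[->]]; last by rewrite ee !inE !eqxx orbT.
  congr (inr (inl _)); apply/val_inj/esym/eqP; rewrite eqEcard (card_edge (valP f)) ee.
  by rewrite cards2 uv andbT; apply/subsetP => x; rewrite !inE => /orP[] /eqP ->.
- by apply/andP => /= -[/eqP uw /eqP vw]; rewrite uw vw eqxx in uv.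
Qed.

(** The two tetrahedra meeting in the oxygen have 4 + 4 - 1 vertices in all. *)
Lemma deg_bridge (e : {e : {set G} | e \in edges G}) : deg (inr (inl e) : S) = 6.
Proof.
have /edgesP[u [v [uv ee]]] := valP e; have nuv := adj_neq uv.
have xe t : (inr (inl e) : S) \in tetrahedron t = (t \in [set u; v]).
  by rewrite in_tetra_oxy /= ee.
rewrite /deg tetra_nbrs (eq_bigl _ _ xe) big_setU1 ?inE //= big_set1.
have := cardsD1 (inr (inl e)) (tetrahedron u :|: tetrahedron v).
rewrite inE xe !inE eqxx /= cardsU (tetraI nuv ee) cards1 !card_tetra.
by move=> [].
Qed.

Local Notation V := #|G|.
Local Notation ndeg2 := #|[set v : G | deg v == 2]|.

Lemma card_edges23 : 2 * #|edges G| + ndeg2 = 3 * V.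
Proof.
rewrite card_edges -sum1_card [X in _ + X]big_mkcond -big_split mulnC -sum_nat_const /=.
by apply: eq_bigr => v _; rewrite inE; case: (deg23 v) => ->.
Qed.

Lemma big_silicate_vertices (R : Type) (idx : R) (op : Monoid.com_law idx)
    (g : nat -> R) :
  \big[op/idx]_(v : S) g (deg v) =
  op (iter (V + ndeg2) (op (g 3)) idx) (iter #|edges G| (op (g 6)) idx).
Proof.
rewrite !big_sumType /=.
under eq_bigr do rewrite deg_silicon.
under [X in op _ (op X _)]eq_bigr do rewrite deg_bridge.
under [X in op _ (op _ X)]eq_bigr do rewrite deg_pendant.
have iter_add m k x :
    iter (m + k) (op x) idx = op (iter m (op x) idx) (iter k (op x) idx).
  by elim: m => [|m IH]; rewrite ?Monoid.mul1m //= IH Monoid.mulmA.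
rewrite !big_const !card_sig [op (iter _ _ _) (iter _ _ _)]Monoid.mulmC.
rewrite Monoid.mulmA iter_add.
by congr (op (op (iter _ _ _) (iter _ _ _)) (iter _ _ _));
  apply: eq_card => x; rewrite !inE.
Qed.

Lemma deg_silicate (x : S) : deg x = 3 + 3 * (deg x == 6).
Proof.
by case: x => [s|[e|v]]; rewrite ?deg_silicon ?deg_bridge ?deg_pendant.
Qed.

(** The vertices of degree 6 are the bridges between tetrahedra: the oxygens
    placed on the edges of G. *)
Definition bridge_ends (e : {set S}) : nat :=
  #|[set x in e | x \in [set x : S | deg x == 6]]|.

Lemma sum_deg_edge (e : {set S}) :
  e \in edges S -> \sum_(x in e) deg x = 6 + 3 * bridge_ends e.
Proof.
move=> he; under eq_bigr do rewrite deg_silicate.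
rewrite big_split /= sum_nat_const (card_edge he) -big_distrr /=.
rewrite /bridge_ends -sum1_card -big_mkcondr /=; congr (_ + 3 * _).
by apply: eq_bigl => x; rewrite !inE.
Qed.

Lemma bridge_ends_le2 (e : {set S}) : e \in edges S -> bridge_ends e < 3.
Proof.
by move=> he; rewrite ltnS -(card_edge he) subset_leq_card //; apply/subsetP => x;
  rewrite inE => /andP[].
Qed.

Lemma deg3_corner (x : S) s : deg x != 6 -> x \in tetrahedron s ->
  x = inl s \/ exists2 w, val w = s & x = inr (inr w).
Proof.
case: x => [t|[f|w]]; rewrite ?in_tetra_sil ?in_tetra_oxy.
- by move=> _ /eqP ->; left.
- by rewrite deg_bridge.
- by move=> _ /eqP ->; right; exists w.
Qed.

(** The only vertices of a tetrahedron that are not bridges are its silicon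
    vertex and, when that vertex has degree 2 in G, its extra oxygen. *)
Lemma edges_without_bridge :
  [set e in edges S | bridge_ends e == 0] =
  [set ([set inl (val v); inr (inr v)] : {set S})
    | v in [set: {v : G | deg v == 2}]].
Proof.
apply/setP => e; rewrite inE; apply/andP/imsetP => [[]|[v _ ->]].
  case/edgesP => x [y [/andP[xy /existsP[s /andP[xs ys]]] ->]].
  rewrite cards_eq0 => /eqP/setP e0.
  have x6 : deg (x : S) != 6 by have := e0 x; rewrite !inE eqxx /= => ->.
  have y6 : deg (y : S) != 6 by have := e0 y; rewrite !inE eqxx orbT /= => ->.
  case: (deg3_corner x6 xs) xy => [->|[v vs ->]];
    case: (deg3_corner y6 ys) => [->|[w ws ->]].
  - by rewrite eqxx.
  - by exists w; rewrite ?inE ?ws.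
  - by exists v; rewrite ?inE ?vs // setUC.
  - by have /val_inj -> : val v = val w; [rewrite vs ws | rewrite eqxx].
split.
  apply/edgesP; exists (inl (val v)), (inr (inr v)); split=> //.
  by apply/andP; split=> //; apply/existsP; exists (val v);
    rewrite in_tetra_sil in_tetra_oxy /= eqxx.
rewrite cards_eq0; apply/eqP/setP => x; rewrite !inE.
by apply/andP => -[/orP[]/eqP->]; rewrite ?deg_silicon ?deg_pendant.
Qed.

Lemma card_edges_without_bridge :
  #|[set e in edges S | bridge_ends e == 0]| = ndeg2.
Proof.
rewrite edges_without_bridge card_imset; last first.
  move=> v w /setP/(_ (inl (val v))); rewrite !inE eqxx => /esym/orP.
  by case=> [/eqP[/val_inj]|/eqP].
transitivity #|{: {v : G | deg v == 2}}|; first by apply: eq_card => v; rewrite !inE.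
by rewrite card_sig; apply: eq_card => v; rewrite !inE.
Qed.

(** Let K1 and K2 be the two cardinals, and t the number of edges with no
    bridge among their ends.  Incidences with bridges give K1 + 2 K2 = 6 E, and
    all incidences give 2 (t + K1 + K2) = 3 (V + t) + 6 E. *)
Lemma card_edges_by_bridges :
  #|[set e in edges S | bridge_ends e == 1]| = 3 * V + ndeg2 /\
  #|[set e in edges S | bridge_ends e == 2]| = 3 * V - 2 * ndeg2.
Proof.
have iter_add a k : iter k (addn a) 0 = k * a by rewrite iter_addn addn0 mulnC.
have deg_sum := big_silicate_vertices addn id.
have size_sum := @big_fibres _ _ addn _ _ 3 bridge_ends (fun=> 1) bridge_ends_le2.
have ends_sum := @big_fibres _ _ addn _ _ 3 bridge_ends id bridge_ends_le2.
have six : \sum_(e in edges S) bridge_ends e = 6 * #|edges G|.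
  rewrite handshake (eq_bigr (fun=> 6)); last by move=> x; rewrite inE => /eqP.
  pose g d := if d == 6 then 6 else 0.
  transitivity (\sum_(x : S) g (deg x)).
    by rewrite big_mkcond; apply: eq_bigr => x _; rewrite inE.
  by rewrite (big_silicate_vertices addn g) /= !iter_add muln0 mulnC.
have := card_edges S; rewrite deg_sum -sum1_card size_sum => {size_sum}.
move: six; rewrite ends_sum !big_ord_recr !big_ord0 /= !iter_add card_edges_without_bridge.
have := card_edges23.
set K1 := #|[set e in edges S | bridge_ends e == 1]|.
set K2 := #|[set e in edges S | bridge_ends e == 2]|.
(* With the cardinals turned into variables the system is linear. *)
move: K1 K2 #|edges G| ndeg2 #|G|; lia.
Qed.

Lemma big_silicate_edges (R : Type) (idx : R) (op : Monoid.com_law idx)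
    (g : nat -> R) :
  \big[op/idx]_(e in edges S) g (\sum_(x in e) deg x) =
  op (op (iter ndeg2 (op (g 6)) idx) (iter (3 * V + ndeg2) (op (g 9)) idx))
     (iter (3 * V - 2 * ndeg2) (op (g 12)) idx).
Proof.
under eq_bigr => e /sum_deg_edge -> do [].
rewrite (big_fibres op (fun k => g (6 + 3 * k)) bridge_ends_le2).
rewrite !big_ord_recr big_ord0 /= Monoid.mul1m.
have [-> ->] := card_edges_by_bridges.
by rewrite card_edges_without_bridge.
Qed.
End Silicate.

(** * The hexagonal tiling *)

Local Open Scope ring_scope.

(** The three forms are twice the inner products of p with w ^ 2, 1 and w, so
    that the region is a regular hexagon with sides orthogonal to the unit
    vectors. *)
Definition in_region (k : nat) (p : point) : bool :=
  [&& `|p.2 - p.1| <= k%:Z, `|2 * p.1 + p.2| <= k%:Z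
    & `|p.1 + 2 * p.2| <= k%:Z].

(** Multiplication by w, the rotation by 60 degrees: w ^ 2 = w - 1. *)
Definition turn (p : point) : point := (- p.2, p.1 + p.2).

Lemma turn_units u : (turn u \in unit_vectors) = (u \in unit_vectors).
Proof.
by case: u => x y; rewrite !inE !xpair_eqE /=; lia.
Qed.

Lemma unit_region u : u \in unit_vectors -> in_region 2 u /\ ~~ is_centre u.
Proof. by rewrite !inE => /or4P[/eqP->|/eqP->|/eqP->|/or3P[]/eqP->]. Qed.

Lemma region_turn k p : in_region k (turn p) = in_region k p.
Proof. by case: p => x y; rewrite /in_region /=; lia. Qed.

Lemma centre_turn p : is_centre (turn p) = is_centre p.
Proof. by case: p => x y; rewrite /is_centre /=; lia. Qed.

Lemma turnD p q : turn (p + q) = turn p + turn q.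
Proof. by case: p q => x y [z t]; rewrite /turn; congr pair => /=; lia. Qed.

Lemma turnN p : turn (- p) = - turn p.
Proof. by case: p => x y; rewrite /turn; congr pair => /=; lia. Qed.

Lemma regionD j k p q :
  in_region j p -> in_region k q -> in_region (j + k) (p + q).
Proof. by case: p q => x y [z t]; rewrite /in_region /=; lia. Qed.

Lemma regionN k p : in_region k (- p) = in_region k p.
Proof. by case: p => x y; rewrite /in_region /=; lia. Qed.

(** On centres the three forms are multiples of 3. *)
Lemma centre_region m p :
  is_centre p -> in_region (3 * m + 1) p = in_region (3 * m) p.
Proof. by case: p => x y; rewrite /is_centre /in_region /=; lia. Qed.

Lemma in_hexagon h p : (p \in hexagon h) = (p - h \in unit_vectors).
Proof.
apply/imfsetP/idP => [[u /= hu ->]|hu]; first by rewrite addrC addKr.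
by exists (p - h) => //; rewrite addrC subrK.
Qed.

(** The hexagons of centres h and h + u + w u share the edge from h + u to
    h + w u.  Every neighbour arises so, and this form is the one used to
    build walks between hexagons. *)
Lemma hex_nbrs_turn h u : is_centre h -> u \in unit_vectors ->
  h + (u + turn u) \in hex_nbrs h.
Proof.
move=> hh hu; rewrite in_hex_nbrs; apply/andP; split.
  case: h u hh hu => x y [z t]; rewrite /is_centre /= => hh _; lia.
have e1 : h + u \in hexagon h by rewrite in_hexagon addrC addKr.
have e2 : h + turn u \in hexagon h by rewrite in_hexagon addrC addKr turn_units.
rewrite /hex_adj; apply/andP; split.
  by apply: contraL hu => /eqP; case: h u {hh e1 e2} => x y [z t] [];
    rewrite !inE !xpair_eqE /=; lia.
apply/existsP; exists [` e1]%fset; apply/existsP; exists [` e2]%fset => /=.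
rewrite /hex_edge e1 e2 !in_hexagon /unit_dist /=.
have -> : h + turn u - (h + u) = turn (turn u).
  by case: h u {hu hh e1 e2} => x y [z t]; rewrite /turn; congr pair => /=; lia.
have -> : h + u - (h + (u + turn u)) = turn (turn (turn (turn u))).
  by case: h u {hu hh e1 e2} => x y [z t]; rewrite /turn; congr pair => /=; lia.
have -> : h + turn u - (h + (u + turn u)) = turn (turn (turn u)).
  by case: h u {hu hh e1 e2} => x y [z t]; rewrite /turn; congr pair => /=; lia.
by rewrite !turn_units hu.
Qed.

Lemma hex_nbrs_diff h k : k \in hex_nbrs h ->
  is_centre k /\
  exists u v, [/\ u \in unit_vectors, v \in unit_vectors & k = h + u - v].
Proof.
rewrite in_hex_nbrs => /andP[ck /andP[_ /existsP[p /existsP[q]]]].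
rewrite /hex_edge => /andP[/and3P[ph _ _] /and3P[pk _ _]]; split=> //.
exists (val p - h), (val p - k); rewrite -!in_hexagon ph pk; split=> //.
by rewrite [h + _]addrC subrK subKr.
Qed.

(** A hexagon of the outermost layer has a neighbour one layer further in.  The
    direction of the step is given by the 60 degree sector that contains k; the
    sectors are cut out by the signs of the three forms. *)
Lemma hex_step m k :
  is_centre k -> in_region (3 * m.+1) k -> ~~ in_region (3 * m) k ->
  exists2 u, u \in unit_vectors & in_region (3 * m) (k - (u + turn u)).
Proof.
case: k => x y; rewrite /is_centre /in_region /= => ck hk hk'.
have [a e] : exists a : int, y = x + 3 * a by exists ((y - x) %/ 3)%Z; lia.
have [c1|c1] := boolP ((y - x > 0) && (2 * x + y >= 0));
  first by exists (0, 1) => //=; lia.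
have [c2|c2] := boolP ((y - x <= 0) && (x + 2 * y > 0));
  first by exists (1, 0) => //=; lia.
have [c3|c3] := boolP ((x + 2 * y <= 0) && (2 * x + y > 0));
  first by exists (1, -1) => //=; lia.
have [c4|c4] := boolP ((y - x < 0) && (2 * x + y <= 0));
  first by exists (0, -1) => //=; lia.
have [c5|c5] := boolP ((y - x >= 0) && (x + 2 * y < 0));
  first by exists (-1, 0) => //=; lia.
by exists (-1, 1) => //=; lia.
Qed.

(** Two unit steps change each form by at most 4, and on centres by a multiple
    of 3, hence by at most 3 for each new layer; conversely [hex_step] leads
    back to the previous layer. *)
Lemma mem_hex_ball m h : (h \in hex_ball m) = is_centre h && in_region (3 * m) h.
Proof.
elim: m h => [|m IH] h /=.
  by rewrite inE; case: h => x y; rewrite xpair_eqE /is_centre /in_region /=; lia.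
rewrite inE IH; apply/idP/idP.
  case/orP => [/andP[-> ]|].
    by case: h => x y; rewrite /in_region /=; lia.
  case/bigfcupP => k; rewrite andbT IH => /andP[ck rk].
  case/hex_nbrs_diff => ch [u [v [/unit_region[ru _] /unit_region[rv _] e]]].
  rewrite ch /= -centre_region // e (_ : 3 * m.+1 + 1 = 3 * m + 2 + 2)%N; last by lia.
  by apply: regionD; [exact: regionD | rewrite regionN].
case/andP => ch rh; rewrite ch /=; case: (boolP (in_region _ h)) => //= nrh.
have [u hu ru] := hex_step ch rh nrh.
have ck : is_centre (h - (u + turn u)).
  by move: ch; case: h u {hu rh nrh ru} => x y [z t]; rewrite /is_centre /=; lia.
apply/bigfcupP; exists (h - (u + turn u)); first by rewrite IH ck ru.
by have := hex_nbrs_turn ck hu; rewrite subrK.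
Qed.

(** * Vertices and degrees of the honeycomb network *)

(** The points (1, 0) + a (1, -2) + b (1, 1).  The vectors (1, -2) and (1, 1)
    are translations of the tiling at an angle of 120 degrees, so these points
    all belong to the same one of the two classes of vertices; an odd number of
    turns exchanges the classes. *)
Definition rhombus_point (a b : nat) : point := (1 + a%:Z + b%:Z, b%:Z - 2 * a%:Z).

Definition HC_point (k a b : nat) : point := iter k turn (rhombus_point a b).

Lemma HC_vertE m p :
  (p \in HC_vert m.+1) = has (fun u => p - u \in hex_ball m) unit_vectors.
Proof.
apply/bigfcupP/hasP => [[h]|[u hu hb]].
  by rewrite andbT in_hexagon => hb hp; exists (p - h) => //; rewrite subKr.
by exists (p - u); rewrite ?hb // in_hexagon subKr.
Qed.

Lemma turn6 p : iter 6 turn p = p.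
Proof. by case: p => x y; rewrite /= /turn; congr pair => /=; lia. Qed.

Lemma hex_ball_turn m h : (turn h \in hex_ball m) = (h \in hex_ball m).
Proof. by rewrite !mem_hex_ball centre_turn region_turn. Qed.

Lemma map_turn_units : perm_eq (map turn unit_vectors) unit_vectors.
Proof. by []. Qed.

(** Some hexagon of the network contains both p and p + u: its centre is
    p - v. *)
Definition has_edge m p u :=
  has (fun v => (p - v \in hex_ball m) && (u + v \in unit_vectors)) unit_vectors.

Lemma has_edge_turn m p u : has_edge m (turn p) (turn u) = has_edge m p u.
Proof.
rewrite /has_edge -(perm_has _ map_turn_units) has_map; apply: eq_has => v /=.
by rewrite -turnN -!turnD hex_ball_turn turn_units.
Qed.

Lemma HC_vert_turn m p : (turn p \in HC_vert m.+1) = (p \in HC_vert m.+1).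
Proof.
rewrite !HC_vertE -(perm_has _ map_turn_units) has_map; apply: eq_has => v /=.
by rewrite -turnN -turnD hex_ball_turn.
Qed.

Lemma count_has_edge_turn m p :
  count (has_edge m (turn p)) unit_vectors = count (has_edge m p) unit_vectors.
Proof.
rewrite -(permP map_turn_units) count_map; apply: eq_count => u /=.
exact: has_edge_turn.
Qed.

Lemma HC_adjE m (p q : HC m.+1) :
  adj p q = (val q - val p \in unit_vectors) && has_edge m (val p) (val q - val p).
Proof.
apply/existsP/andP => [[h]|[pq /hasP[v hv /andP[hb hq]]]].
  rewrite /hex_edge !in_hexagon => /and3P[hp hq pq]; split=> //.
  apply/hasP; exists (val p - val h) => //; rewrite subKr (valP h).
  by rewrite addrA subrK hq.
exists [` hb]%fset; rewrite /hex_edge /unit_dist !in_hexagon /= subKr hv pq.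
by rewrite opprB addrCA addrC hq.
Qed.

Lemma deg_HC m (p : HC m.+1) : deg p = count (has_edge m (val p)) unit_vectors.
Proof.
suff /perm_size : perm_eq (map val (enum [set q | adj p q]))
    (map (fun u => val p + u) (filter (has_edge m (val p)) unit_vectors)).
  by rewrite !size_map => e; rewrite /deg cardE e size_filter.
apply: uniq_perm.
- by rewrite (map_inj_uniq val_inj) enum_uniq.
- by rewrite map_inj_uniq ?filter_uniq //; apply: addrI.
move=> q; apply/mapP/mapP => [[r]|[u]].
  rewrite mem_enum inE HC_adjE andbC => pr ->; exists (val r - val p).
    by rewrite mem_filter.
  by rewrite addrC subrK.
rewrite mem_filter => /andP[] /[dup] pu /hasP[v hv /andP[hb uv]] hu ->.
have hq : val p + u \in HC_vert m.+1.
  rewrite HC_vertE; apply/hasP; exists (u + v) => //.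
  by rewrite opprD addrA addrK.
exists [` hq]%fset; rewrite // mem_enum inE HC_adjE /=.
by rewrite [val p + u]addrC addrK hu.
Qed.

Lemma rhombus_in_HC m a b : (a < m.+1)%N -> (b < m.+1)%N ->
  rhombus_point a b \in HC_vert m.+1.
Proof.
move=> am bm; rewrite HC_vertE; apply/hasP; exists (1, 0) => //.
by rewrite mem_hex_ball /is_centre /in_region /rhombus_point /=; lia.
Qed.

(** The first three points are the centres of the hexagons of the tiling
    around the vertex; the last three are vertices. *)
Lemma rhombus_hexagons m a b : (a < m.+1)%N -> (b < m.+1)%N ->
  [/\ rhombus_point a b - (1, 0) \in hex_ball m,
     (rhombus_point a b - (0, -1) \in hex_ball m) = (b < m)%N,
     (rhombus_point a b - (-1, 1) \in hex_ball m) = (a < m)%N && (b < m)%N &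
  [/\ rhombus_point a b - (-1, 0) \notin hex_ball m,
      rhombus_point a b - (0, 1) \notin hex_ball m &
      rhombus_point a b - (1, -1) \notin hex_ball m]].
Proof.
rewrite !mem_hex_ball /is_centre /in_region /rhombus_point /= => am bm.
by split; [| | |split]; lia.
Qed.

(** A vertex lying in one hexagon of the network has two neighbours, and a
    vertex lying in two or three hexagons has three. *)
Lemma rhombus_count m a b : (a < m.+1)%N -> (b < m.+1)%N ->
  count (has_edge m (rhombus_point a b)) unit_vectors = (if b == m then 2 else 3)%N.
Proof.
move=> am bm.
have [h1 h2 h3 [/negbTE h4 /negbTE h5 /negbTE h6]] := rhombus_hexagons am bm.
rewrite /has_edge /unit_vectors /= h1 h2 h3 h4 h5 h6 /=.
have -> : (b < m)%N = (b != m) by rewrite ltn_neqAle -[(b <= m)%N]ltnS bm andbT.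
by case: (b == m); case: (a < m)%N.
Qed.

(** The 120 degree cone spanned by (1, -2) and (1, 1), restricted to the class
    of vertices that contains (1, 0). *)
Definition in_sector (p : point) : bool :=
  [&& (p.2 - p.1 == 2 %[mod 3])%Z, p.2 - p.1 < 0 & 0 < 2 * p.1 + p.2].

(** Three turns of the cone, each by 120 degrees, cover one class of vertices,
    and the intermediate turns cover the other. *)
Lemma sector_turns p : ~~ is_centre p ->
  exists2 j, (0 < j <= 6)%N & in_sector (iter j turn p).
Proof.
case: p => x y; rewrite /is_centre /in_sector /= => cp.
(* An odd number of turns is needed exactly when y - x = 1 mod 3. *)
have [r2 | r1] : (y - x = 2 %[mod 3])%Z \/ (y - x = 1 %[mod 3])%Z by lia.
  have [c1 | c1] := ltP (y - x) 0.
    have [c2 | c2] := ltP 0 (2 * x + y).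
      by exists 6%N => //=; apply/and3P; split; [apply/eqP | |]; lia.
    by exists 2%N => //=; apply/and3P; split; [apply/eqP | |]; lia.
  have [c3 | c3] := ltP 0 (x + 2 * y).
    by exists 4%N => //=; apply/and3P; split; [apply/eqP | |]; lia.
  by exists 2%N => //=; apply/and3P; split; [apply/eqP | |]; lia.
have [c1 | c1] := ltP (y - x) 0.
  have [c3 | c3] := ltP (x + 2 * y) 0.
    by exists 1%N => //=; apply/and3P; split; [apply/eqP | |]; lia.
  by exists 5%N => //=; apply/and3P; split; [apply/eqP | |]; lia.
have [c2 | c2] := ltP (2 * x + y) 0.
  by exists 3%N => //=; apply/and3P; split; [apply/eqP | |]; lia.
by exists 5%N => //=; apply/and3P; split; [apply/eqP | |]; lia.
Qed.

Lemma sector_rhombus m p : in_region (3 * m + 2) p -> in_sector p ->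
  exists a b, [/\ (a < m.+1)%N, (b < m.+1)%N & p = rhombus_point a b].
Proof.
case: p => x y; rewrite /in_region /in_sector /rhombus_point /= => rp sp.
(* On [rhombus_point a b] the forms y - x and 2 x + y are - 3 a - 1 and
   3 b + 2. *)
exists `|((x - y) %/ 3)%Z|%N, `|((2 * x + y) %/ 3)%Z|%N.
by split; [lia | lia | congr pair; lia].
Qed.

Lemma HC_point_exists m p : p \in HC_vert m.+1 ->
  exists k a b, [/\ (k < 6)%N, (a < m.+1)%N, (b < m.+1)%N & p = HC_point k a b].
Proof.
rewrite HC_vertE => /hasP[u /unit_region[ru cu]]; rewrite mem_hex_ball => /andP[ch rh].
have {ru} rp : in_region (3 * m + 2) p by rewrite -(subrK u p); apply: regionD.
have {cu ch} cp : ~~ is_centre p.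
  by move: cu ch; case: (p) u {rp rh} => x y [z t]; rewrite /is_centre /=; lia.
have [j /andP[j0 j6] sj] := sector_turns cp.
have rj : in_region (3 * m + 2) (iter j turn p).
  by elim: (j) => //= i; rewrite region_turn.
have [a [b [am bm e]]] := sector_rhombus rj sj.
(* Turning p by j steps reaches the rhombus; 6 - j more steps lead back. *)
exists (6 - j)%N, a, b; split=> //; first by lia.
by rewrite /HC_point -e -iterD subnK ?turn6.
Qed.

Lemma HC_point_inj k a b k' a' b' : (k < 6)%N -> (k' < 6)%N ->
  HC_point k a b = HC_point k' a' b' -> [/\ k = k', a = a' & b = b'].
Proof.
move: k k' => [|[|[|[|[|[|//]]]]]] [|[|[|[|[|[|//]]]]]] _ _;
  by rewrite /HC_point /rhombus_point /turn /= => -[] *; split; lia.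
Qed.

Lemma HC_point_in m k a b : (a < m.+1)%N -> (b < m.+1)%N ->
  HC_point k a b \in HC_vert m.+1.
Proof.
by move=> am bm; elim: k => [|k IH]; rewrite ?rhombus_in_HC //= HC_vert_turn.
Qed.

Definition HC_index (m : nat) (t : 'I_6 * 'I_m.+1 * 'I_m.+1) : HC m.+1 :=
  [` HC_point_in t.1.1 (ltn_ord t.1.2) (ltn_ord t.2)]%fset.

Lemma HC_index_bij m : bijective (@HC_index m).
Proof.
have inj : injective (@HC_index m).
  move=> [[k a] b] [[k' a'] b'] /(congr1 val) /= /HC_point_inj[] //.
  by move=> /val_inj -> /val_inj -> /val_inj ->.
apply: (inj_card_bij inj); rewrite -(card_codom inj).
apply/subset_leq_card/subsetP => v _; apply/codomP.
have [k [a [b [hk ha hb e]]]] := HC_point_exists (valP v).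
by exists (Ordinal hk, Ordinal ha, Ordinal hb); apply: val_inj.
Qed.

Lemma deg_HC_index m t : deg (@HC_index m t) = (if t.2 == ord_max then 2 else 3)%N.
Proof.
case: t => [[k a] b]; rewrite deg_HC -val_eqE -(rhombus_count (ltn_ord a) (ltn_ord b)).
rewrite [val _]/(HC_point k a b) /HC_point.
by elim: (nat_of_ord k) => // i IH; rewrite iterS count_has_edge_turn.
Qed.

Lemma HC_deg23 m (v : HC m.+1) : deg v = 2%N \/ deg v = 3%N.
Proof.
have [g _ gK] := HC_index_bij m; rewrite -(gK v) deg_HC_index.
by case: ifP; [left | right].
Qed.

Lemma card_HC m : #|HC m.+1| = (6 * m.+1 ^ 2)%N.
Proof.
by rewrite -(bij_eq_card (HC_index_bij m)) !card_prod !card_ord mulnA.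
Qed.

Lemma card_HC_deg2 m : #|[set v : HC m.+1 | deg v == 2%N]| = (6 * m.+1)%N.
Proof.
rewrite -(on_card_preimset (f := @HC_index m)); last exact/onW_bij/HC_index_bij.
have -> : @HC_index m @^-1: [set v | deg v == 2%N] = setX setT [set ord_max].
  apply/setP => -[ka b]; rewrite !inE deg_HC_index /=.
  by case: (b == ord_max).
by rewrite cardsX cardsT card_prod !card_ord cards1 muln1.
Qed.

(** * The indices of the silicate network *)

Lemma powR_exp (R : realType) (x c : R) (k : nat) : (x `^ c) ^+ k = x `^ (c * k%:R).
Proof. by rewrite -powR_mulrn ?powR_ge0 // -powRrM. Qed.

Lemma powR_natD (R : realType) (k : nat) (x y : R) :
  (0 < k)%N -> k%:R `^ (x + y) = k%:R `^ x * k%:R `^ y.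
Proof. by move=> k0; rewrite powRD // pnatr_eq0 -lt0n k0 implybT. Qed.

Lemma powR_natM (R : realType) (j k : nat) (x : R) :
  (j * k)%:R `^ x = j%:R `^ x * k%:R `^ x.
Proof. by rewrite natrM powRM ?ler0n. Qed.

Lemma expn_6_9_12 (i j k : nat) :
  (6 ^ i * 9 ^ j * 12 ^ k = 2 ^ (i + 2 * k) * 3 ^ (i + 2 * j + k))%N.
Proof.
rewrite (expnMn 2 3) (expnMn (2 ^ 2) 3) -[9%N]/(3 ^ 2)%N -!expnM.
by rewrite -[X in (X * _)%N]mulnA mulnACA -!expnD.
Qed.

Section Counts.
Context (R : realType) (n : nat) (hn : (1 <= n)%N).
Local Open Scope nat_scope.

Lemma HC_counts : [/\ forall v : HC n, deg v = 2 \/ deg v = 3,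
  #|HC n| = 6 * n ^ 2, #|[set v : HC n | deg v == 2]| = 6 * n &
  #|edges (HC n)| = 9 * n ^ 2 - 3 * n].
Proof.
case: n hn => // m _; have h := @HC_deg23 m.
have := card_edges23 h; rewrite card_HC card_HC_deg2 => e.
by split=> //; lia.
Qed.

Lemma iter_muln_1 x k : iter k (muln x) 1 = x ^ k.
Proof. by rewrite iter_muln muln1. Qed.

(** Needed because the subtractions of the exponents are truncated. *)
Lemma leq_sqr : n <= n ^ 2.
Proof. by rewrite -{1}[n]expn1 leq_pexp2l. Qed.

Lemma Pi2_SL : Pi2 (SL n) = 2 ^ (54 * n ^ 2 - 18 * n) * 3 ^ (72 * n ^ 2).
Proof.
have [h hV h2 hE] := HC_counts.
rewrite Pi2_vertices (big_silicate_vertices h muln (fun d => d ^ d)) hV h2 hE.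
have e6 : 6 ^ 6 = 2 ^ 6 * 3 ^ 6 by rewrite -expnMn.
rewrite !iter_muln_1 e6 expnMn -!expnM [LHS]mulnCA -expnD.
by congr (_ ^ _ * _ ^ _); have := leq_sqr; lia.
Qed.

Lemma Pi1star_SL :
  Pi1star (SL n) = 2 ^ (36 * n ^ 2 - 18 * n) * 3 ^ (54 * n ^ 2 + 6 * n).
Proof.
have [h hV h2 hE] := HC_counts.
rewrite /Pi1star (big_silicate_edges h muln id) /= hV h2 !iter_muln_1 expn_6_9_12.
by congr (_ ^ _ * _ ^ _); have := leq_sqr; lia.
Qed.

Local Open Scope ring_scope.

Lemma Pi1c_SL (c : R) : Pi1c c (SL n) =
  2 `^ (9 * n%:R ^+ 2 * c - 3 * n%:R * c) *
  3 `^ (15 * n%:R ^+ 2 * c + 3 * n%:R * c).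
Proof.
have [h hV h2 hE] := HC_counts.
rewrite /Pi1c (big_silicate_vertices h *%R (fun d => d%:R `^ c)) /= !iter_mulr_1.
rewrite !powR_exp (powR_natM 2 3) mulrCA -powR_natD // hV h2 hE.
have leE : (3 * n <= 9 * n ^ 2)%N by have := leq_sqr; lia.
by congr (_ `^ _ * _ `^ _); rewrite ?natrD natrB // !natrM ?natrX; ring.
Qed.

Lemma chi_SL (alpha : R) : chi alpha (SL n) =
  n%:R * 6 `^ (alpha + 1) + 3 `^ (2 * alpha + 1) * (6 * n%:R ^+ 2 + 2 * n%:R) +
  2 `^ (2 * alpha + 1) * 3 `^ (alpha + 1) * (3 * n%:R ^+ 2 - 2 * n%:R).
Proof.
have [h hV h2 hE] := HC_counts.
have iter_addr (x : R) k : iter k (+%R x) 0 = x * k%:R.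
  by rewrite iter_addr_0 mulr_natr.
rewrite /chi (big_silicate_edges h +%R (fun d => d%:R `^ alpha)) /= !iter_addr.
rewrite hV h2 (powR_natM 3 3) (powR_natM 4 3) (powR_natM 2 2) (powR_natM 2 3).
(* Everything is expressed by 2 `^ alpha and 3 `^ alpha. *)
rewrite (mulrDl 1 1 alpha) mul1r !powR_natD // !powRr1 ?ler0n // (powR_natM 2 3).
rewrite natrB; last by have := leq_sqr; lia.
by ring.
Qed.
End Counts.

Unset Implicit Arguments.

Theorem theorem2p1p1 (R : realType) (n : nat) (alpha c : R) (hn : (1 <= n)%N) :
  [/\ Pi1c c (SL n) =
        2 `^ (9 * n%:R ^+ 2 * c - 3 * n%:R * c) *
        3 `^ (15 * n%:R ^+ 2 * c + 3 * n%:R * c),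
      Pi2 (SL n) = (2 ^ (54 * n ^ 2 - 18 * n) * 3 ^ (72 * n ^ 2))%N,
      chi alpha (SL n) =
        n%:R * 6 `^ (alpha + 1) +
        3 `^ (2 * alpha + 1) * (6 * n%:R ^+ 2 + 2 * n%:R) +
        2 `^ (2 * alpha + 1) * 3 `^ (alpha + 1) *
          (3 * n%:R ^+ 2 - 2 * n%:R)
    & Pi1star (SL n) =
        (2 ^ (36 * n ^ 2 - 18 * n) * 3 ^ (54 * n ^ 2 + 6 * n))%N].
Proof.
split; [exact: Pi1c_SL | exact: Pi2_SL | exact: chi_SL | exact: Pi1star_SL].
Qed.
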